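(* Let $R$ be a commutative noetherian ring, and let $\mathcal{S}_{1}$ and $\mathcal{S}_{2}$ be Serre subcategories of $R\text{-}\mathrm{Mod}$. Then the following conditions are equivalent: (1) The subcategory $(\mathcal{S}_{1}, \mathcal{S}_{2})$ is a Serre subcategory of $R\text{-}\mathrm{Mod}$; (2) One has $(\mathcal{S}_{2}, \mathcal{S}_{1}) \subseteq (\mathcal{S}_{1}, \mathcal{S}_{2})$.
   Context: $R\text{-}\mathrm{Mod}$ denotes the category of all (unitary) $R$-modules. All full subcategories are assumed closed under isomorphisms. A Serre subcategory of an abelian category is a full subcategory closed under subobjects, quotient objects and extensions (in particular it contains the zero object). For Serre subcategories $\mathcal{S}, \mathcal{T}$ of $R\text{-}\mathrm{Mod}$, $(\mathcal{S}, \mathcal{T})$ denotes the full subcategory of $R\text{-}\mathrm{Mod}$ consisting of all $R$-modules $M$ for which there exists a short exact sequence $0 \to S \to M \to T \to 0$ of $R$-modules with $S \in \mathcal{S}$ and $T \in \mathcal{T}$. *)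

(* Defs.v *)
From mathcomp Require Import all_boot all_algebra.
From mathcomp Require Import boolp classical_sets.

Set Implicit Arguments.
Unset Strict Implicit.
Unset Printing Implicit Defensive.

Import GRing.Theory.
Local Open Scope ring_scope.
Local Open Scope classical_set_scope.

(* Rings are [comPzRingType], so the zero ring is not excluded. An ideal of [R]
   is a submodule of the regular module [R^o]; the library's [idealr_closed]
   would only cover proper ideals. *)
Definition is_ideal (R : comPzRingType) (I : set R) : Prop :=
  submod_closed ([in I] : {pred R^o}).

Definition finitely_generated_ideal (R : comPzRingType) (I : set R) : Prop :=
  exists (n : nat) (a : 'I_n -> R),
    I = [set x | exists c : 'I_n -> R, x = \sum_(i < n) c i * a i].

Definition noetherian_ring (R : comPzRingType) : Prop :=
  forall I : set R, is_ideal I -> finitely_generated_ideal I.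

(* A full subcategory of R-Mod is given by its class of objects. *)
Definition full_subcategory (R : comPzRingType) := lmodType R -> Prop.

Definition sub_subcategory (R : comPzRingType) (S T : full_subcategory R) : Prop :=
  forall M : lmodType R, S M -> T M.

Definition short_exact (R : comPzRingType) (L M N : lmodType R)
    (f : {linear L -> M}) (g : {linear M -> N}) : Prop :=
  [/\ injective f,
      forall y : M, g y = 0 <-> exists x : L, f x = y &
      forall z : N, exists y : M, g y = z].

(* Subobjects and quotient objects are given by arbitrary injective and
   surjective linear maps. *)
Record serre_subcategory (R : comPzRingType) (S : full_subcategory R) : Prop :=
  SerreSubcategory {
    serre_iso : forall (M N : lmodType R) (f : {linear M -> N}),
      bijective f -> S M -> S N;
    serre_zero : forall M : lmodType R, (forall x : M, x = 0) -> S M;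
    serre_sub : forall (L M : lmodType R) (f : {linear L -> M}),
      injective f -> S M -> S L;
    serre_quot : forall (M N : lmodType R) (g : {linear M -> N}),
      (forall z : N, exists y : M, g y = z) -> S M -> S N;
    serre_ext : forall (L M N : lmodType R)
        (f : {linear L -> M}) (g : {linear M -> N}),
      short_exact f g -> S L -> S N -> S M
  }.

(* [ext_subcategory S T] is (S, T): the submodule lies in [S] and the quotient
   in [T]. *)
Definition ext_subcategory (R : comPzRingType) (S T : full_subcategory R) :
    full_subcategory R :=
  fun M : lmodType R =>
    exists (L N : lmodType R) (f : {linear L -> M}) (g : {linear M -> N}),
      [/\ short_exact f g, S L & T N].

(* Main.v *)
Require Import Defs.
From HB Require Import structures.
From mathcomp Require Import all_boot all_algebra.
From mathcomp Require Import boolp classical_sets.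
From mathcomp Require Import ring_quotient.

(** The class (S1, S2) is always closed under subobjects and quotient objects:
given 0 -> A -> M -> B -> 0 with A in S1 and B in S2, a submodule K of M is an
extension of a submodule of B by a submodule of A, and a quotient of M is an
extension of a quotient of B by a quotient of A. So (S1, S2) is Serre exactly
when it is closed under extensions.

If it is, then it contains S1 and S2, and hence every extension of an object of
S1 by an object of S2: this is the inclusion (S2, S1) <= (S1, S2).

Conversely let 0 -> L -> M -> N -> 0 be exact, with A <= L in S1 and
B = L/A in S2, and with C <= N in S1 and D = N/C in S2. From bottom to top, M
is filtered with factors A, B, C, D, lying in S1, S2, S1, S2. The two middle
factors form a module E of (S2, S1), and the inclusion rewrites E as an
extension of some Y in S2 by some X in S1. The factors of M become A, X, Y, D,
in S1, S1, S2, S2; as S1 and S2 are closed under extensions, M is in (S1, S2)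
([ext_subcategory_ext]).

The argument is carried out with kernels, cokernels and the maps that they
induce ([kernel_exists], [cokernel_exists], [lift_linear], [factor_linear]), so
that no submodule or quotient has to be manipulated as a set. *)

Set Implicit Arguments.
Unset Strict Implicit.
Unset Printing Implicit Defensive.

Import GRing.Theory.
Local Open Scope ring_scope.
Local Open Scope quotient_scope.

(** * Kernels, cokernels and induced maps *)

Definition surj_fun (X Y : Type) (f : X -> Y) := forall y, exists x, f x = y.

Definition exact_at (R : pzRingType) (L M N : lmodType R)
    (f : {linear L -> M}) (g : {linear M -> N}) :=
  forall y, g y = 0 <-> exists x, f x = y.

Section KernelCokernel.
Variables (R : pzRingType) (M N : lmodType R) (g : {linear M -> N}).

Definition ker_pred : {pred M} := [pred x | g x == 0].

Lemma ker_pred_closed : submod_closed ker_pred.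
Proof.
split=> [|a x y]; rewrite !inE ?linear0 // => /eqP gx /eqP gy.
by rewrite linearP gx gy scaler0 addr0.
Qed.
HB.instance Definition _ :=
  GRing.isSubmodClosed.Build R M ker_pred ker_pred_closed.

Definition kernel := {x : M | x \in ker_pred}.
HB.instance Definition _ := SubChoice.on kernel.
HB.instance Definition _ := [SubChoice_isSubLmodule of kernel by <:].

Lemma kernel_exists :
  exists (K : lmodType R) (k : {linear K -> M}), injective k /\ exact_at k g.
Proof.
exists kernel, (\val : {linear _ -> _}); split; first exact: val_inj.
move=> y; split=> [gy|[x <-]].
  have yK : y \in ker_pred by rewrite inE gy.
  by exists (exist _ y yK).
by apply/eqP; have := valP x; rewrite inE.
Qed.

Definition im_pred : {pred N} := [pred y | `[< exists x, g x = y >]].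

Lemma im_predP y : y \in im_pred <-> exists x, g x = y.
Proof. by split=> ?; apply/asboolP. Qed.

Lemma im_pred_closed : submod_closed im_pred.
Proof.
split=> [|a y z]; first by apply/im_predP; exists 0; rewrite linear0.
move=> /im_predP[x <-] /im_predP[x' <-]; apply/im_predP.
by exists (a *: x + x'); rewrite linearP.
Qed.
HB.instance Definition _ :=
  GRing.isZmodClosed.Build N im_pred (GRing.submod_closedB im_pred_closed).

Definition cokernel := Quotient.quot im_pred.
HB.instance Definition _ := GRing.Zmodule.on cokernel.

Definition coker_proj (y : N) : cokernel := \pi_(Quotient.quot im_pred) y.

Lemma coker_proj_eq y z :
  coker_proj y = coker_proj z <-> exists x, g x = y - z.
Proof. by rewrite -im_predP Quotient.idealrBE; split=> /eqP. Qed.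

Lemma coker_proj_surj : surj_fun coker_proj.
Proof. by move=> z; exists (repr z); rewrite /coker_proj reprK. Qed.

Lemma coker_projD y z : coker_proj (y + z) = coker_proj y + coker_proj z.
Proof. by rewrite /coker_proj Quotient.pi_add. Qed.

(** The additive quotient becomes a module by scaling representatives: this is
independent of their choice because the image of [g] is stable under scaling
([coker_projZ]), and each module axiom then descends from [N]. *)
Definition coker_scale (a : R) (z : cokernel) : cokernel :=
  coker_proj (a *: repr z).

Lemma coker_projZ a y : coker_proj (a *: y) = coker_scale a (coker_proj y).
Proof.
have /coker_proj_eq[x xE] : coker_proj y = coker_proj (repr (coker_proj y)).
  by rewrite /coker_proj reprK.
by apply/coker_proj_eq; exists (a *: x); rewrite -scalerBr -xE linearZ.
Qed.

Lemma coker_scaleA a b z :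
  coker_scale a (coker_scale b z) = coker_scale (a * b) z.
Proof. by have [y <-] := coker_proj_surj z; rewrite -!coker_projZ scalerA. Qed.

Lemma coker_scale1 : left_id 1 coker_scale.
Proof.
by move=> z; have [y <-] := coker_proj_surj z; rewrite -coker_projZ scale1r.
Qed.

Lemma coker_scaleDr : right_distributive coker_scale +%R.
Proof.
move=> a y z; have [u <-] := coker_proj_surj y.
have [v <-] := coker_proj_surj z.
by rewrite -coker_projD -!coker_projZ scalerDr coker_projD.
Qed.

Lemma coker_scaleDl z : {morph coker_scale^~ z : a b / a + b}.
Proof.
move=> a b; have [y <-] := coker_proj_surj z.
by rewrite -!coker_projZ scalerDl coker_projD.
Qed.

HB.instance Definition _ := GRing.Zmodule_isLmodule.Build R cokernel
  coker_scaleA coker_scale1 coker_scaleDr coker_scaleDl.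

Lemma coker_proj_is_linear : linear coker_proj.
Proof. by move=> a y z; rewrite coker_projD coker_projZ. Qed.

HB.instance Definition _ :=
  GRing.isLinear.Build R N cokernel *:%R coker_proj coker_proj_is_linear.

Lemma cokernel_exists :
  exists (Q : lmodType R) (q : {linear N -> Q}), surj_fun q /\ exact_at g q.
Proof.
exists cokernel, (coker_proj : {linear _ -> _}); split.
  exact: coker_proj_surj.
by move=> y; rewrite -(linear0 coker_proj) coker_proj_eq subr0.
Qed.

End KernelCokernel.

Lemma linear_of_fun (R : pzRingType) (M N : lmodType R) (f : M -> N) :
  linear f -> exists h : {linear M -> N}, h =1 f.
Proof.
move=> lin; pose m := GRing.isLinear.Build R M N *:%R f lin.
pose h : {linear M -> N} := HB.pack f m.
by exists h.
Qed.

(** Universal property of a submodule; choosing preimages gives a linear map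
because they are unique. *)
Lemma lift_linear (R : pzRingType) (K M X : lmodType R)
    (k : {linear K -> M}) (h : {linear X -> M}) :
  injective k -> (forall x, exists y, k y = h x) ->
  exists h' : {linear X -> K}, forall x, k (h' x) = h x.
Proof.
move=> kI /choice[f fE]; have [|h' h'E] := @linear_of_fun _ _ _ f.
  by move=> a x y; apply: kI; rewrite fE !linearP !fE.
by exists h' => x; rewrite h'E.
Qed.

(** Universal property of a quotient; the value on a class is computed on a
chosen representative, and two representatives differ by an element that [h]
kills. *)
Lemma factor_linear (R : pzRingType) (M Q X : lmodType R)
    (q : {linear M -> Q}) (h : {linear M -> X}) :
  surj_fun q -> (forall x, q x = 0 -> h x = 0) ->
  exists h' : {linear Q -> X}, forall x, h' (q x) = h x.
Proof.
move=> /choice[s sK] kerq.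
have hE x y : q x = q y -> h x = h y.
  move=> qxy; apply/eqP; rewrite -subr_eq0 -linearB; apply/eqP/kerq.
  by rewrite linearB qxy subrr.
have [|h' h'E] := @linear_of_fun _ _ _ (h \o s).
  by move=> a x y /=; rewrite -linearP; apply: hE; rewrite linearP !sK.
by exists h' => x; rewrite h'E /=; apply: hE; rewrite sK.
Qed.

Lemma linear_inj (R : pzRingType) (M N : lmodType R) (f : {linear M -> N}) :
  (forall x, f x = 0 -> x = 0) -> injective f.
Proof.
move=> f0 x y fxy; apply/eqP; rewrite -subr_eq0; apply/eqP/f0.
by rewrite linearB fxy subrr.
Qed.

(** * Closure properties of extension classes *)

Section Closure.
Variables (R : comPzRingType) (S T : full_subcategory R).
Hypotheses (serreS : serre_subcategory S) (serreT : serre_subcategory T).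

Lemma ext_subcategory_zero (M : lmodType R) :
  (forall x : M, x = 0) -> ext_subcategory S T M.
Proof.
move=> M0; exists M, M, idfun, \0; split.
- split=> // z; first by split=> // _; exists z.
  by exists 0; rewrite [RHS]M0.
- exact: serre_zero M0.
- exact: serre_zero M0.
Qed.

Lemma sub_ext_subcategoryl : sub_subcategory S (ext_subcategory S T).
Proof.
move=> M SM; exists M, 'rV[R]_0, idfun, \0; split=> //.
- split=> // z; first by split=> // _; exists z.
  by exists 0; rewrite [RHS]thinmx0.
- by apply: serre_zero => // x; rewrite thinmx0.
Qed.

Lemma sub_ext_subcategoryr : sub_subcategory T (ext_subcategory S T).
Proof.
move=> M TM; exists 'rV[R]_0, M, \0, idfun; split=> //.
- split=> [x y _|y|z]; first by rewrite [x]thinmx0 [y]thinmx0.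
    by split=> [yE|[x <-]] //; exists 0.
  by exists z.
- by apply: serre_zero => // x; rewrite thinmx0.
Qed.

(** With A <= M and B = M/A, the submodule K contains K :&: A, the kernel of
K -> B, and the quotient K / (K :&: A) embeds into B. *)
Lemma ext_subcategory_sub (K M : lmodType R) (h : {linear K -> M}) :
  injective h -> ext_subcategory S T M -> ext_subcategory S T K.
Proof.
move=> hI [A [B [i [p [[iI ip _] SA TB]]]]].
have [A' [i' [i'I i'E]]] := kernel_exists (p \o h).
have [B' [p' [p'S p'E]]] := cokernel_exists i'.
have [|a aE] := @lift_linear _ _ _ _ i (h \o i') iI.
  by move=> x; apply/ip/i'E; exists x.
have [|b bE] := @factor_linear _ _ _ _ p' (p \o h) p'S.
  by move=> x /p'E /i'E.
exists A', B', i', p'; split=> //.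
- apply: (serre_sub serreS (f := a)) SA => x y axy.
  by apply/i'I/hI; have := congr1 i axy; rewrite !aE.
- apply: (serre_sub serreT (f := b)) TB; apply: linear_inj => z.
  by have [x <-] := p'S z; rewrite bE => /i'E/p'E.
Qed.

(** With A <= M and B = M/A, the image A' of A in the quotient N of M is the
kernel of N -> N/A', and N/A' is a quotient of B. *)
Lemma ext_subcategory_quot (M N : lmodType R) (h : {linear M -> N}) :
  surj_fun h -> ext_subcategory S T M -> ext_subcategory S T N.
Proof.
move=> hS [A [B [i [p [[_ ip pS] SA TB]]]]].
have [B' [p' [p'S p'E]]] := cokernel_exists (h \o i).
have [A' [i' [i'I i'E]]] := kernel_exists p'.
have [|a aE] := @lift_linear _ _ _ _ i' (h \o i) i'I.
  by move=> x; apply/i'E/p'E; exists x.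
have [|b bE] := @factor_linear _ _ _ _ p (p' \o h) pS.
  by move=> _ /ip[x <-]; apply/p'E; exists x.
exists A', B', i', p'; split=> //.
- apply: (serre_quot serreS (g := a)) SA => z.
  have /i'E/p'E[x xE] : exists z', i' z' = i' z by exists z.
  by exists x; apply: i'I; rewrite aE.
- apply: (serre_quot serreT (g := b)) TB => z.
  have [y <-] := p'S z; have [x <-] := hS y.
  by exists (p x); rewrite bE.
Qed.

(** In the filtration of M with factors A, B, C, D, the module Q = M/A has
factors B, C, D and E <= Q has factors B, C. Once E is filtered by X and
Y = E/X, the submodule Z <= M over X has factors A, X and the quotient
W = Q/X = M/Z has factors Y, D. *)
Lemma ext_subcategory_ext (L M N : lmodType R)
    (f : {linear L -> M}) (g : {linear M -> N}) :
  sub_subcategory (ext_subcategory T S) (ext_subcategory S T) ->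
  short_exact f g -> ext_subcategory S T L -> ext_subcategory S T N ->
  ext_subcategory S T M.
Proof.
move=> TS_ST [fI fg gS].
move=> [A [B [i [p [[iI ip pS] SA TB]]]]] [C [D [j [q [[jI jq qS] SC TD]]]]].
have [Q [pi [piS piE]]] := cokernel_exists (f \o i).
have [|gQ gQE] := @factor_linear _ _ _ _ pi g piS.
  by move=> _ /piE[x <-]; apply/fg; exists (i x).
have [E [e [eI eE]]] := kernel_exists (q \o gQ).
have gfE x : g (f x) = 0 by apply/fg; exists x.
have ST_E : ext_subcategory S T E.
  (* E is an extension of C by B: B -> E lifts L/A -> M/A, and E -> C lifts the
     restriction to E of Q -> N. *)
  apply: TS_ST.
  have [|bQ bQE] := @factor_linear _ _ _ _ p (pi \o f) pS.
    by move=> _ /ip[x <-]; apply/piE; exists x.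
  have [|b bE] := @lift_linear _ _ _ _ e bQ eI.
    move=> z; have [x <-] := pS z; apply/eE.
    by rewrite bQE /= gQE gfE linear0.
  have [|c cE] := @lift_linear _ _ _ _ j (gQ \o e) jI.
    by move=> x; apply/jq/eE; exists x.
  exists B, C, b, c; split=> //; split.
  - apply: linear_inj => z; have [x <-] := pS z => bx0.
    have /piE[a /fI ax] : pi (f x) = 0 by rewrite -[LHS]bQE -bE bx0 linear0.
    by apply/ip; exists a.
  - move=> y; split=> [cy0|[z <-]].
      have [m mE] := piS (e y).
      have /fg[x xm] : g m = 0 by rewrite -gQE mE -[LHS]cE cy0 linear0.
      by exists (p x); apply: eI; rewrite bE bQE /= xm mE.
    apply: jI; have [x <-] := pS z.
    by rewrite cE /= bE bQE /= gQE gfE linear0.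
  - move=> z; have [m mE] := gS (j z).
    have /eE[y yE] : (q \o gQ) (pi m) = 0.
      by rewrite /= gQE mE; apply/jq; exists z.
    by exists y; apply: jI; rewrite cE /= yE gQE mE.
have [X [Y [k [r [[kI kr rS] SX TY]]]]] := ST_E.
have [W [w [wS wE]]] := cokernel_exists (e \o k).
have [Z [z [zI zE]]] := kernel_exists (w \o pi).
exists Z, W, z, (w \o pi); split.
- split=> // y; have [u <-] := wS y; have [m <-] := piS u.
  by exists m.
(* Z is an extension of X by A. *)
- have ekI : injective (e \o k) by exact: inj_comp.
  have [|a aE] := @lift_linear _ _ _ _ z (f \o i) zI.
    move=> x; apply/zE; rewrite /= (_ : pi _ = 0) ?linear0 //.
    by apply/piE; exists x.
  have [|b bE] := @lift_linear _ _ _ _ (e \o k) (pi \o z) ekI.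
    by move=> x; apply/wE/zE; exists x.
  apply: (serre_ext serreS (f := a) (g := b)) SA SX; split.
  + by move=> x y axy; apply/iI/fI; have := congr1 z axy; rewrite !aE.
  + move=> y; split=> [by0|[x <-]].
      have /piE[x xE] : pi (z y) = 0 by rewrite -[LHS]bE by0 linear0.
      by exists x; apply: zI; rewrite aE.
    apply: ekI; rewrite bE /= aE !linear0.
    by apply/piE; exists x.
  + move=> x; have [m mE] := piS (e (k x)).
    have /zE[y yE] : (w \o pi) m = 0 by rewrite /= mE; apply/wE; exists x.
    by exists y; apply: ekI; rewrite bE /= yE.
(* W is an extension of D by Y. *)
- have [|a aE] := @factor_linear _ _ _ _ r (w \o e) rS.
    by move=> _ /kr[x <-]; apply/wE; exists x.
  have [|b bE] := @factor_linear _ _ _ _ w (q \o gQ) wS.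
    by move=> _ /wE[x <-]; apply/eE; exists (k x).
  apply: (serre_ext serreT (f := a) (g := b)) TY TD; split.
  + apply: linear_inj => y; have [u <-] := rS y.
    by rewrite aE => /wE[x /eI xu]; apply/kr; exists x.
  + move=> y; split=> [|[y' <-]].
      have [u <-] := wS y; rewrite bE => /eE[v <-].
      by exists (r v); rewrite aE.
    have [u <-] := rS y'; rewrite aE /= bE.
    by apply/eE; exists u.
  + move=> d; have [n <-] := qS d; have [m <-] := gS n.
    by exists (w (pi m)); rewrite bE /= gQE.
Qed.

End Closure.

(** * The criterion *)

Theorem theorem3p2 (R : comPzRingType) (noethR : noetherian_ring R)
    (S1 S2 : full_subcategory R)
    (serreS1 : serre_subcategory S1) (serreS2 : serre_subcategory S2) :
  serre_subcategory (ext_subcategory S1 S2) <->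
  sub_subcategory (ext_subcategory S2 S1) (ext_subcategory S1 S2).
Proof.
split=> [serreST M [L [N [f [g [exfg S2L S1N]]]]]|S21_12].
  apply: (serre_ext serreST exfg); first exact: sub_ext_subcategoryr.
  exact: sub_ext_subcategoryl.
split=> [M N f [f' _ f'K]|M|L M f|M N g|L M N f g].
- by apply: ext_subcategory_quot => // y; exists (f' y).
- exact: ext_subcategory_zero.
- exact: ext_subcategory_sub.
- exact: ext_subcategory_quot.
- exact: ext_subcategory_ext.
Qed.
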